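(* Let $\alpha_0,\ldots,\alpha_4$ be complex parameters with $\alpha_0+\alpha_1+\alpha_2+\alpha_3+\alpha_4=1$. Consider a polynomial Hamiltonian system $\frac{dq_i}{dt}=\frac{\partial H}{\partial p_i}$, $\frac{dp_i}{dt}=-\frac{\partial H}{\partial q_i}$ ($i=1,\ldots,4$) with Hamiltonian $H\in\mathbb{C}(t)[q_1,p_1,\ldots,q_4,p_4]$. Assume that (B1) $\deg(H)=3$ with respect to $q_1,p_1,\ldots,q_4,p_4$; (B2) this system becomes again a polynomial Hamiltonian system in each of the coordinate systems $r_i$ ($i=0,1,\ldots,4$): $$\begin{aligned} r_0:\ &x_0=\tfrac1{q_1},\ y_0=-\left(\left(p_1+\tfrac{q_2^2}{4}\right)q_1+\alpha_0\right)q_1,\ z_0=q_2,\ w_0=p_2+\tfrac{q_1q_2}{2},\\ &l_0=q_3,\ m_0=p_3,\ n_0=q_4,\ u_0=p_4;\\ r_1:\ &x_1=q_1,\ y_1=p_1,\ z_1=\tfrac1{q_2},\ w_1=-(q_2p_2+\alpha_1)q_2,\ l_1=q_3,\ m_1=p_3,\ n_1=q_4,\ u_1=p_4;\\ r_2:\ &x_2=q_1-\tfrac{q_2}{2},\ y_2=p_1+\tfrac{q_2^2}{4},\ z_2=\tfrac1{q_2},\\ &w_2=-\left(\left(p_2+\tfrac{p_1+p_4}{2}+p_3+t+\tfrac{q_1q_2}{2}+\tfrac{q_3q_4}{2}-\tfrac{q_2q_3}{4}\right)q_2+\alpha_2\right)q_2,\\ &l_2=q_3-q_2,\ m_2=p_3-\tfrac{q_2^2}{4}+\tfrac{q_2q_4}{2},\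 n_2=q_4-\tfrac{q_2}{2},\ u_2=p_4+\tfrac{q_2q_3}{2}-\tfrac{q_2^2}{4};\\ r_3:\ &x_3=q_1,\ y_3=p_1,\ z_3=q_2,\ w_3=p_2,\ l_3=\tfrac1{q_3},\ m_3=-(q_3p_3+\alpha_3)q_3,\ n_3=q_4,\ u_3=p_4;\\ r_4:\ &x_4=q_1,\ y_4=p_1,\ z_4=q_2,\ w_4=p_2,\ l_4=q_3,\ m_4=p_3+\tfrac{q_3q_4}{2},\ n_4=\tfrac1{q_4},\\ &u_4=-\left(\left(p_4+\tfrac{q_3^2}{4}\right)q_4+\alpha_4\right)q_4. \end{aligned}$$ Then the system coincides with the system $$\begin{aligned} \frac{dq_1}{dt}&=2q_1^2+p_1+2t+4p_2+3p_4, & \frac{dp_1}{dt}&=-4q_1p_1+2q_2p_2-2\alpha_0,\\ \frac{dq_2}{dt}&=q_2^2-4p_2+4p_1-2q_1q_2, & \frac{dp_2}{dt}&=-2q_2p_2+2q_1p_2-\alpha_1,\\ \frac{dq_3}{dt}&=q_3^2-4p_3+4p_4-2q_3q_4, & \frac{dp_3}{dt}&=-2q_3p_3+2q_4p_3-\alpha_3,\\ \frac{dq_4}{dt}&=2q_4^2+p_4+2t+3p_1+4p_3, & \frac{dp_4}{dt}&=-4q_4p_4+2q_3p_3-2\alpha_4, \end{aligned}$$ whose polynomial Hamiltonian is $$G(q_1,p_1,q_2,p_2,t;\alpha_0,\alpha_1)+G(q_4,p_4,q_3,p_3,t;\alpha_4,\alpha_3)-\tfrac32p_1^2-\tfrac32p_4^2+3p_1p_4,$$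 where $G(q_1,p_1,q_2,p_2,t;\alpha_0,\alpha_1)=2(q_1^2p_1+p_1^2+tp_1+\alpha_0q_1)+q_2^2p_2-2p_2^2+\alpha_1q_2+4p_1p_2-2q_1q_2p_2$.
   Context: Condition (B2) is to be read as follows: writing $r_j(K)$ for the expression of $K$ in the coordinates $(x_j,y_j,z_j,w_j,l_j,m_j,n_j,u_j)$ (obtained by inverting the birational map $r_j$), the functions $r_j(H)$ for $j=0,1,3,4$ and $r_2(H-q_2)$ are polynomials in the corresponding coordinates $x_j,y_j,z_j,w_j,l_j,m_j,n_j,u_j$, with coefficients in $\mathbb{C}(t)$. The correction $-q_2$ accounts for the explicit $t$-dependence of $r_2$. *)

(* Defs.v *)
From HB Require Import structures.
From mathcomp Require Import all_boot all_order all_algebra.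
From mathcomp Require Import reals complex.
From mathcomp Require Import ring.
From mathcomp.multinomials Require Import mpoly.

Set Implicit Arguments.
Unset Strict Implicit.
Unset Printing Implicit Defensive.

Import GRing.Theory.
Local Open Scope ring_scope.

(* C and C(t); C is [complex R], with R a model of the real numbers. *)
Notation Ct R := {fraction {poly complex R}}.

Definition tvar (R : realType) : Ct R := tofrac 'X.
Definition cst (R : realType) (a : complex R) : Ct R := tofrac a%:P.

(* C(t)[q1, p1, q2, p2, q3, p3, q4, p4], the variables being numbered in this
   order. The same ring is used for the polynomials in (x, y, z, w, l, m, n, u);
   these correspond to (q1, p1, q2, p2, q3, p3, q4, p4) in this order. *)
Notation Pol R := {mpoly (Ct R)[8]}.
Notation Rat R := {fraction {mpoly (Ct R)[8]}}.

Definition i_q1 : 'I_8 := @Ordinal 8 0 isT.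
Definition i_p1 : 'I_8 := @Ordinal 8 1 isT.
Definition i_q2 : 'I_8 := @Ordinal 8 2 isT.
Definition i_p2 : 'I_8 := @Ordinal 8 3 isT.
Definition i_q3 : 'I_8 := @Ordinal 8 4 isT.
Definition i_p3 : 'I_8 := @Ordinal 8 5 isT.
Definition i_q4 : 'I_8 := @Ordinal 8 6 isT.
Definition i_p4 : 'I_8 := @Ordinal 8 7 isT.

Section Coordinates.
Variable F : fieldType.
Implicit Types (x y z w l m n u t a : F).
Implicit Types (v : 8.-tuple F).

Definition app8 (A : Type) (f : F -> F -> F -> F -> F -> F -> F -> F -> A)
    (v : 8.-tuple F) : A :=
  f (tnth v i_q1) (tnth v i_p1) (tnth v i_q2) (tnth v i_p2)
    (tnth v i_q3) (tnth v i_p3) (tnth v i_q4) (tnth v i_p4).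

Definition r0 a (q1 p1 q2 p2 q3 p3 q4 p4 : F) : 8.-tuple F :=
  [tuple q1^-1; - ((p1 + q2 ^+ 2 / 4%:R) * q1 + a) * q1;
         q2; p2 + q1 * q2 / 2%:R; q3; p3; q4; p4].

Definition r1 a (q1 p1 q2 p2 q3 p3 q4 p4 : F) : 8.-tuple F :=
  [tuple q1; p1; q2^-1; - (q2 * p2 + a) * q2; q3; p3; q4; p4].

Definition r2 t a (q1 p1 q2 p2 q3 p3 q4 p4 : F) : 8.-tuple F :=
  [tuple q1 - q2 / 2%:R; p1 + q2 ^+ 2 / 4%:R; q2^-1;
         - ((p2 + (p1 + p4) / 2%:R + p3 + t + q1 * q2 / 2%:R
             + q3 * q4 / 2%:R - q2 * q3 / 4%:R) * q2 + a) * q2;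
         q3 - q2; p3 - q2 ^+ 2 / 4%:R + q2 * q4 / 2%:R;
         q4 - q2 / 2%:R; p4 + q2 * q3 / 2%:R - q2 ^+ 2 / 4%:R].

Definition r3 a (q1 p1 q2 p2 q3 p3 q4 p4 : F) : 8.-tuple F :=
  [tuple q1; p1; q2; p2; q3^-1; - (q3 * p3 + a) * q3; q4; p4].

Definition r4 a (q1 p1 q2 p2 q3 p3 q4 p4 : F) : 8.-tuple F :=
  [tuple q1; p1; q2; p2; q3; p3 + q3 * q4 / 2%:R;
         q4^-1; - ((p4 + q3 ^+ 2 / 4%:R) * q4 + a) * q4].

(* The inverses of the birational maps above: lemmas [r0K] to [s4K]. *)
Definition s0 a x y z w l m n u : 8.-tuple F :=
  [tuple x^-1; - (y * x + a) * x - z ^+ 2 / 4%:R;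
         z; w - x^-1 * z / 2%:R; l; m; n; u].

Definition s1 a x y z w l m n u : 8.-tuple F :=
  [tuple x; y; z^-1; - (w * z + a) * z; l; m; n; u].

Definition s2 t a x y z w l m n u : 8.-tuple F :=
  let q2 := z^-1 in
  let q1 := x + q2 / 2%:R in
  let p1 := y - q2 ^+ 2 / 4%:R in
  let q3 := l + q2 in
  let q4 := n + q2 / 2%:R in
  let p3 := m + q2 ^+ 2 / 4%:R - q2 * q4 / 2%:R in
  let p4 := u - q2 * q3 / 2%:R + q2 ^+ 2 / 4%:R in
  let p2 := - (w * z + a) * z - ((p1 + p4) / 2%:R + p3 + t + q1 * q2 / 2%:R
             + q3 * q4 / 2%:R - q2 * q3 / 4%:R) in
  [tuple q1; p1; q2; p2; q3; p3; q4; p4].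

Definition s3 a x y z w l m n u : 8.-tuple F :=
  [tuple x; y; z; w; l^-1; - (m * l + a) * l; n; u].

Definition s4 a x y z w l m n u : 8.-tuple F :=
  [tuple x; y; z; w; l; m - l * n^-1 / 2%:R;
         n^-1; - (u * n + a) * n - l ^+ 2 / 4%:R].

Lemma tuple8E (v : 8.-tuple F) (v1 v2 v3 v4 v5 v6 v7 v8 : F) :
  [/\ v1 = tnth v i_q1, v2 = tnth v i_p1, v3 = tnth v i_q2 & v4 = tnth v i_p2] ->
  [/\ v5 = tnth v i_q3, v6 = tnth v i_p3, v7 = tnth v i_q4 & v8 = tnth v i_p4] ->
  [tuple v1; v2; v3; v4; v5; v6; v7; v8] = v.
Proof.
move=> [-> -> -> ->] [-> -> -> ->]; apply: eq_from_tnth => i.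
by case: i => [[|[|[|[|[|[|[|[|i]]]]]]]] hi] //;
  rewrite [LHS](tnth_nth 0) /=; congr (tnth v _); apply: val_inj.
Qed.

Hypothesis F2 : 2%:R != 0 :> F.

Let F4 : 4%:R != 0 :> F.
Proof. by rewrite (natrM F 2 2) mulf_neq0. Qed.

Ltac inv8 v0 :=
  apply: tuple8E; split; rewrite /app8 !(tnth_nth 0) //=;
  field; rewrite ?oner_neq0 ?F2 ?F4 ?v0.

Lemma r0K a v : tnth v i_q1 != 0 -> app8 (s0 a) (app8 (r0 a) v) = v.
Proof. rewrite (tnth_nth 0) => /= v0; by inv8 v0. Qed.

Lemma s0K a v : tnth v i_q1 != 0 -> app8 (r0 a) (app8 (s0 a) v) = v.
Proof. rewrite (tnth_nth 0) => /= v0; by inv8 v0. Qed.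

Lemma r1K a v : tnth v i_q2 != 0 -> app8 (s1 a) (app8 (r1 a) v) = v.
Proof. rewrite (tnth_nth 0) => /= v0; by inv8 v0. Qed.

Lemma s1K a v : tnth v i_q2 != 0 -> app8 (r1 a) (app8 (s1 a) v) = v.
Proof. rewrite (tnth_nth 0) => /= v0; by inv8 v0. Qed.

Lemma r2K t a v : tnth v i_q2 != 0 -> app8 (s2 t a) (app8 (r2 t a) v) = v.
Proof. rewrite (tnth_nth 0) => /= v0; by inv8 v0. Qed.

Lemma s2K t a v : tnth v i_q2 != 0 -> app8 (r2 t a) (app8 (s2 t a) v) = v.
Proof. rewrite (tnth_nth 0) => /= v0; by inv8 v0. Qed.

Lemma r3K a v : tnth v i_q3 != 0 -> app8 (s3 a) (app8 (r3 a) v) = v.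
Proof. rewrite (tnth_nth 0) => /= v0; by inv8 v0. Qed.

Lemma s3K a v : tnth v i_q3 != 0 -> app8 (r3 a) (app8 (s3 a) v) = v.
Proof. rewrite (tnth_nth 0) => /= v0; by inv8 v0. Qed.

Lemma r4K a v : tnth v i_q4 != 0 -> app8 (s4 a) (app8 (r4 a) v) = v.
Proof. rewrite (tnth_nth 0) => /= v0; by inv8 v0. Qed.

Lemma s4K a v : tnth v i_q4 != 0 -> app8 (r4 a) (app8 (s4 a) v) = v.
Proof. rewrite (tnth_nth 0) => /= v0; by inv8 v0. Qed.

End Coordinates.

Section Expression.
Variable R : realType.

Definition ratC (c : Ct R) : Rat R := tofrac c%:MP.
Definition coords : 8.-tuple (Rat R) := [tuple tofrac 'X_i | i < 8].

(* The expression of K in new coordinates, where s gives the old coordinates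
   as rational functions of the new ones. *)
Definition expr_in (s : 8.-tuple (Rat R)) (K : Pol R) : Rat R :=
  mmap ratC (tnth s) K.

Definition is_polynomial (f : Rat R) : Prop := exists P : Pol R, f = tofrac P.

(* The third map depends on t through w; since dz /\ dw, up to sign, contributes
   dq2 /\ dt, the Hamiltonian of the transformed system is the expression of
   H - q2. *)
Definition r_polynomial (a0 a1 a2 a3 a4 : complex R) (H : Pol R) : Prop :=
  let c a := ratC (cst a) in
  [/\ is_polynomial (expr_in (app8 (s0 (c a0)) coords) H),
      is_polynomial (expr_in (app8 (s1 (c a1)) coords) H),
      is_polynomial
        (expr_in (app8 (s2 (ratC (tvar R)) (c a2)) coords) (H - 'X_i_q2)),
      is_polynomial (expr_in (app8 (s3 (c a3)) coords) H)
    & is_polynomial (expr_in (app8 (s4 (c a4)) coords) H)].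

(* Time derivatives of (q1, p1, q2, p2, q3, p3, q4, p4). *)
Definition ham_field (H : Pol R) : 8.-tuple (Pol R) :=
  [tuple H^`M(i_p1); - H^`M(i_q1); H^`M(i_p2); - H^`M(i_q2);
         H^`M(i_p3); - H^`M(i_q3); H^`M(i_p4); - H^`M(i_q4)].

Definition target_field (a0 a1 a3 a4 : complex R) : 8.-tuple (Pol R) :=
  let c a : Pol R := (cst a)%:MP in
  let t : Pol R := (tvar R)%:MP in
  let q1 : Pol R := 'X_i_q1 in let p1 : Pol R := 'X_i_p1 in
  let q2 : Pol R := 'X_i_q2 in let p2 : Pol R := 'X_i_p2 in
  let q3 : Pol R := 'X_i_q3 in let p3 : Pol R := 'X_i_p3 in
  let q4 : Pol R := 'X_i_q4 in let p4 : Pol R := 'X_i_p4 in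
  [tuple
    2%:R * q1 ^+ 2 + p1 + 2%:R * t + 4%:R * p2 + 3%:R * p4;
    - 4%:R * q1 * p1 + 2%:R * q2 * p2 - 2%:R * c a0;
    q2 ^+ 2 - 4%:R * p2 + 4%:R * p1 - 2%:R * q1 * q2;
    - 2%:R * q2 * p2 + 2%:R * q1 * p2 - c a1;
    q3 ^+ 2 - 4%:R * p3 + 4%:R * p4 - 2%:R * q3 * q4;
    - 2%:R * q3 * p3 + 2%:R * q4 * p3 - c a3;
    2%:R * q4 ^+ 2 + p4 + 2%:R * t + 3%:R * p1 + 4%:R * p3;
    - 4%:R * q4 * p4 + 2%:R * q3 * p3 - 2%:R * c a4].

Definition Gham (q1 p1 q2 p2 t a0 a1 : Pol R) : Pol R :=
  2%:R * (q1 ^+ 2 * p1 + p1 ^+ 2 + t * p1 + a0 * q1)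
  + q2 ^+ 2 * p2 - 2%:R * p2 ^+ 2 + a1 * q2
  + 4%:R * p1 * p2 - 2%:R * q1 * q2 * p2.

Definition target_ham (a0 a1 a3 a4 : complex R) : Pol R :=
  let c a : Pol R := (cst a)%:MP in
  let t : Pol R := (tvar R)%:MP in
  let q1 : Pol R := 'X_i_q1 in let p1 : Pol R := 'X_i_p1 in
  let q2 : Pol R := 'X_i_q2 in let p2 : Pol R := 'X_i_p2 in
  let q3 : Pol R := 'X_i_q3 in let p3 : Pol R := 'X_i_p3 in
  let q4 : Pol R := 'X_i_q4 in let p4 : Pol R := 'X_i_p4 in
  Gham q1 p1 q2 p2 t (c a0) (c a1) + Gham q4 p4 q3 p3 t (c a4) (c a3)
  - (3%:R / 2%:R) *: p1 ^+ 2 - (3%:R / 2%:R) *: p4 ^+ 2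
  + 3%:R * p1 * p4.

End Expression.

(* Main.v *)
Require Import Defs.
From HB Require Import structures.
From Stdlib Require Import ZArith.
From mathcomp Require Import all_boot all_order all_algebra.
From mathcomp Require Import reals complex.
From mathcomp Require Import ssrZ ring.
From mathcomp.multinomials Require Import mpoly.

Set Implicit Arguments.
Unset Strict Implicit.
Unset Printing Implicit Defensive.

Import GRing.Theory.
Local Open Scope ring_scope.

(** Condition (B2) is affine in H, and its inhomogeneous part, the correction
    - q2 in the third chart, is the same for all H. So if H and G both have
    degree at most 3 and satisfy (B2), then K = H - G has degree at most 3 and
    its expression in each of the five charts is a polynomial. The theorem
    follows from two facts.

    The Hamiltonian G of the statement satisfies (B2) ([target_regular]): its
    expressions in the charts are written out in [ham_chart0] to [ham_chart4].
    They have no poles, except that in the third chart a term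
    (a0 + a1 + a2 + a3 + a4 - 1) / z appears, which is where the normalization
    of the parameters enters.

    A polynomial K of degree at most 3 whose five expressions are polynomials
    is constant ([regular_cubic_const]). In each chart exactly one coordinate v
    is inverted, and D = 8 v^2 is a common denominator of the old coordinates,
    s_j = N_j / D. If c_e is the coefficient of K at the exponent e, then
    D^3 K(s) is the sum over e of c_e D^(3 - |e|) N^e, a polynomial in the new
    coordinates, and the absence of a pole says that its coefficients at
    monomials of degree less than 6 in v vanish ([chart_rowsP]). This is a
    system of linear equations in the 165 unknowns c_e, with coefficients in
    Z[a0, a1, a3, a4, t] once a2 is replaced by 1 - a0 - a1 - a3 - a4. It can
    be solved by eliminating unknowns with nonzero integer pivots only
    ([elimination]), so that its solutions do not depend on the values of the
    parameters: all c_e with e <> 0 vanish. Conceptually, the second and fourth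
    charts bound the degree of K in q2, q3 by that in p2, p3, up to the
    combinations q2^2 p2 + a1 q2 and q3^2 p3 + a3 q3. With the equations of the
    first and fifth charts, and those of the third one that come from polar
    terms other than 1 / z, only the combinations of 1 and G remain. Finally
    lambda G has the polar part
    lambda (a0 + a1 + a2 + a3 + a4) / z = lambda / z in the third chart. *)

(** * Formal sums with exponent vectors as keys *)

Notation expo := (seq nat).

(** The exponents of the variables of a polynomial are stored without trailing
    zeros, a form that addition preserves: equal monomials that arise in a
    computation have equal keys and are merged. *)
Fixpoint eadd (e f : expo) : expo :=
  match e, f with
  | [::], _ => f
  | _, [::] => e
  | i :: e', j :: f' => (i + j)%N :: eadd e' f'
  end.

Lemma nth_eadd e f i : nth 0 (eadd e f) i = (nth 0 e i + nth 0 f i)%N.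
Proof.
by elim: e f i => [|x e IHe] [|y f] [|i] //=; rewrite ?addn0 ?nth_nil.
Qed.

Fixpoint esame (n : nat) (e f : expo) : bool :=
  if n is n'.+1 then
    (head 0 e == head 0 f)%N && esame n' (behead e) (behead f)
  else true.

Lemma esameP n e f :
  reflect (forall i, (i < n)%N -> nth 0 e i = nth 0 f i) (esame n e f).
Proof.
elim: n e f => [|n IHn] e f /=; first by apply: ReflectT.
apply: (iffP andP) => [[/eqP e0 /IHn e1] [|i] ltin|eef].
- by rewrite !nth0.
- by have:= e1 i ltin; rewrite !nth_behead.
split; first by apply/eqP; have:= eef 0%N isT; rewrite !nth0.
by apply/IHn => i ltin; rewrite !nth_behead eef.
Qed.

Arguments esame : simpl never.

(** Coefficients are given by bare operations: the sums are meant to be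
    computed, and are used with integers and then with polynomials in the
    parameters as coefficients. *)
Section FormalSums.
Variables (T : Type) (add mul : T -> T -> T) (is0 : T -> bool).
Notation fsum := (seq (expo * T)).

Fixpoint fins (e : expo) (s : T) (f : fsum) : fsum :=
  match f with
  | [::] => if is0 s then [::] else [:: (e, s)]
  | (e', s') :: f' =>
    if e == e' then
      let s1 := add s s' in if is0 s1 then f' else (e, s1) :: f'
    else (e', s') :: fins e s f'
  end.

Definition fadd (f g : fsum) : fsum :=
  foldr (fun x h => fins x.1 x.2 h) g f.

Definition fscale (s : T) (f : fsum) : fsum :=
  [seq (x.1, mul s x.2) | x <- f].

Definition fmul (f g : fsum) : fsum :=
  foldr (fun x h =>
    fadd [seq (eadd x.1 y.1, mul x.2 y.2) | y <- g] h) [::] f.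

Definition fcoef (zero : T) (test : pred expo) (f : fsum) : T :=
  foldr (fun x s => if test x.1 then add x.2 s else s) zero f.

Section Value.
Variables (A : comNzRingType) (ev : T -> A) (chi : expo -> A).
Hypothesis ev_add : forall s t, ev (add s t) = ev s + ev t.
Hypothesis ev_mul : forall s t, ev (mul s t) = ev s * ev t.
Hypothesis ev_is0 : forall s, is0 s -> ev s = 0.

(** When chi is multiplicative this is the value of a polynomial; when chi is
    an arbitrary family of unknowns it is the value of a linear form. *)
Definition fval (f : fsum) : A := \sum_(x <- f) ev x.2 * chi x.1.

Lemma fval_nil : fval [::] = 0.
Proof. exact: big_nil. Qed.

Lemma fval_cons x f : fval (x :: f) = ev x.2 * chi x.1 + fval f.
Proof. exact: big_cons. Qed.

Lemma fval_ins e s f : fval (fins e s f) = ev s * chi e + fval f.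
Proof.
elim: f => [|[e' s'] f IHf] /=.
  by case: ifP => [/ev_is0 ->|_]; rewrite !(fval_cons, fval_nil) ?mul0r ?addr0.
case: eqP => [->|_]; last by rewrite !fval_cons /= IHf addrCA.
case: ifP => [/ev_is0|_]; rewrite !fval_cons /= ev_add; last first.
  by rewrite mulrDl addrA.
by rewrite addrA -mulrDl => ->; rewrite mul0r add0r.
Qed.

Lemma fval_add f g : fval (fadd f g) = fval f + fval g.
Proof.
elim: f => [|x f IHf] /=; first by rewrite fval_nil add0r.
by rewrite fval_ins IHf fval_cons addrA.
Qed.

Lemma fval_scale s f : fval (fscale s f) = ev s * fval f.
Proof.
rewrite /fval big_map mulr_sumr; apply: eq_bigr => x _.
by rewrite ev_mul mulrA.
Qed.

Lemma fval_mul f g : {morph chi : e e' / eadd e e' >-> e * e'} ->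
  fval (fmul f g) = fval f * fval g.
Proof.
move=> chiM; elim: f => [|x f IHf] /=; first by rewrite fval_nil mul0r.
rewrite fval_add IHf fval_cons mulrDl; congr (_ + _).
rewrite /fval big_map mulr_sumr; apply: eq_bigr => y _.
by rewrite ev_mul chiM mulrACA.
Qed.

Lemma fval_coef zero test f : ev zero = 0 ->
  ev (fcoef zero test f) = \sum_(x <- f | test x.1) ev x.2.
Proof.
move=> ev0; elim: f => [|x f IHf] /=; first by rewrite big_nil.
by rewrite big_cons; case: ifP => _; rewrite ?ev_add IHf.
Qed.

End Value.
End FormalSums.

(** * Computable polynomials in the parameters and in the coordinates *)

Definition ppoly := seq (expo * Z).
Definition padd : ppoly -> ppoly -> ppoly := fadd Z.add (Z.eqb Z0).
Definition pmul : ppoly -> ppoly -> ppoly := fmul Z.add Z.mul (Z.eqb Z0).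
Definition pcst (z : Z) : ppoly := [:: ([::], z)].
Definition pvar (i : nat) : ppoly := [:: (rcons (nseq i 0%N) 1%N, Zpos xH)].
Definition popp : ppoly -> ppoly := pmul (pcst (Zneg xH)).

Definition xpoly := seq (expo * ppoly).
Definition xadd : xpoly -> xpoly -> xpoly := fadd padd (@nilp _).
Definition xmul : xpoly -> xpoly -> xpoly := fmul padd pmul (@nilp _).
Definition xcst (p : ppoly) : xpoly := [:: ([::], p)].
Definition xvar (i : nat) : xpoly :=
  [:: (rcons (nseq i 0%N) 1%N, pcst (Zpos xH))].
Definition xexp (f : xpoly) (n : nat) : xpoly :=
  iter n (xmul f) (xcst (pcst (Zpos xH))).
Definition xopp (f : xpoly) : xpoly := xmul (xcst (pcst (Zneg xH))) f.
Definition xnat (n : nat) : xpoly := xcst (pcst (Z.of_nat n)).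
Definition xpar (i : nat) : xpoly := xcst (pvar i).
Definition xcoef (test : pred expo) : xpoly -> ppoly := fcoef padd [::] test.
Definition xscale : ppoly -> xpoly -> xpoly := fscale pmul.

Arguments xadd : simpl never.
Arguments xmul : simpl never.
Arguments xcst : simpl never.
Arguments xvar : simpl never.
Arguments xexp : simpl never.
Arguments xopp : simpl never.
Arguments xnat : simpl never.
Arguments xpar : simpl never.

Declare Scope xpoly_scope.
Delimit Scope xpoly_scope with xpoly.
Bind Scope xpoly_scope with xpoly.
Infix "+" := xadd : xpoly_scope.
Infix "*" := xmul : xpoly_scope.
Infix "^+" := xexp : xpoly_scope.
Notation "- f" := (xopp f) : xpoly_scope.
Notation "f - g" := (xadd f (xopp g)) : xpoly_scope.

Definition emon (n : nat) (e : expo) : 'X_{1..n} :=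
  [multinom nth 0 e i | i < n].

Lemma emon_nth n e i : emon n e i = nth 0 e i.
Proof. exact: mnmE. Qed.

Lemma emon_nil n : emon n [::] = 0%MM.
Proof. by apply/mnmP => i; rewrite emon_nth mnm0E nth_nil. Qed.

Lemma emonM n : {morph emon n : e f / eadd e f >-> (e + f)%MM}.
Proof. by move=> e f; apply/mnmP => i; rewrite mnmDE !emon_nth nth_eadd. Qed.

Lemma emonE n e f : (emon n e == emon n f) = esame n e f.
Proof.
apply/eqP/esameP => [/mnmP ef i ltin|ef].
  by have:= ef (Ordinal ltin); rewrite !emon_nth.
by apply/mnmP => i; rewrite !emon_nth ef.
Qed.

Lemma nth_unit i j : nth 0 (rcons (nseq i 0%N) 1%N) j = (i == j).
Proof.
rewrite nth_rcons size_nseq nth_nseq eq_sym.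
by case: ltngtP => // ->.
Qed.

Section Values.
Variables (F : fieldType) (a : seq F).

Definition zval (z : Z) : F := (int_of_Z z)%:~R.
Definition param_mon (e : expo) : F := \prod_(i < size a) a`_i ^+ nth 0 e i.
Definition pval (p : ppoly) : F := fval zval param_mon p.

Lemma zval1 : zval (Zpos xH) = 1.
Proof. by []. Qed.

Lemma zval_nat n : zval (Z.of_nat n) = n%:R.
Proof. by rewrite /zval (_ : int_of_Z _ = n) // -[RHS]Z_of_intK. Qed.

Lemma zvalD s t : zval (s + t) = zval s + zval t.
Proof. by rewrite /zval (raddfD int_of_Z) rmorphD. Qed.

Lemma zvalM s t : zval (s * t) = zval s * zval t.
Proof. by rewrite /zval (rmorphM int_of_Z) rmorphM. Qed.

Lemma zval_is0 s : Z.eqb Z0 s -> zval s = 0.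
Proof. by move/Z.eqb_spec <-. Qed.

Lemma param_mon1 : param_mon [::] = 1.
Proof. by rewrite /param_mon big1 // => i _; rewrite nth_nil. Qed.

Lemma param_monM : {morph param_mon : e f / eadd e f >-> e * f}.
Proof.
move=> e f; rewrite /param_mon -big_split; apply: eq_bigr => i _ /=.
by rewrite nth_eadd exprD.
Qed.

Lemma pvalD p q : pval (padd p q) = pval p + pval q.
Proof. exact: fval_add zvalD zval_is0 p q. Qed.

Lemma pvalM p q : pval (pmul p q) = pval p * pval q.
Proof. exact: fval_mul zvalD zvalM zval_is0 p q param_monM. Qed.

Lemma pval_cst z : pval (pcst z) = zval z.
Proof. by rewrite /pval fval_cons fval_nil param_mon1 mulr1 addr0. Qed.

Lemma pval_var i : (i < size a)%N -> pval (pvar i) = a`_i.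
Proof.
move=> lti; rewrite /pval fval_cons fval_nil mul1r addr0 /= /param_mon.
rewrite (bigD1 (Ordinal lti)) //= big1 ?mulr1 => [|j neq_ji].
  by rewrite nth_unit eqxx.
rewrite nth_unit; case: eqP => // ij; case/eqP: neq_ji; exact: val_inj.
Qed.

Lemma pval_nil p : nilp p -> pval p = 0.
Proof. by move/nilP->; rewrite /pval fval_nil. Qed.

Definition xval (f : xpoly) : {mpoly F[8]} :=
  fval (fun p => (pval p)%:MP) (fun e => 'X_[emon 8 e]) f.

Let evD p q :
  (pval (padd p q))%:MP = (pval p)%:MP + (pval q)%:MP :> {mpoly F[8]}.
Proof. by rewrite pvalD mpolyCD. Qed.

Let evM p q :
  (pval (pmul p q))%:MP = (pval p)%:MP * (pval q)%:MP :> {mpoly F[8]}.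
Proof. by rewrite pvalM mpolyCM. Qed.

Let ev_nil p : nilp p -> (pval p)%:MP = 0 :> {mpoly F[8]}.
Proof. by move/pval_nil->; rewrite mpolyC0. Qed.

Lemma xvalD f g : xval (xadd f g) = xval f + xval g.
Proof. exact: fval_add evD ev_nil f g. Qed.

Lemma xvalM f g : xval (xmul f g) = xval f * xval g.
Proof.
by apply: fval_mul evD evM ev_nil f g _ => e e'; rewrite emonM mpolyXD.
Qed.

Lemma xval_cst p : xval (xcst p) = (pval p)%:MP.
Proof. by rewrite /xval fval_cons fval_nil emon_nil mpolyX0 mulr1 addr0. Qed.

Lemma xvalN f : xval (xopp f) = - xval f.
Proof. by rewrite xvalM xval_cst pval_cst mpolyCN mpolyC1 mulN1r. Qed.

Lemma xval_nat n : xval (xnat n) = n%:R.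
Proof. by rewrite xval_cst pval_cst zval_nat mpolyC_nat. Qed.

Lemma xval_var (i : 'I_8) : xval (xvar i) = 'X_i.
Proof.
rewrite /xval fval_cons fval_nil pval_cst zval1 mpolyC1 mul1r addr0 /=.
by congr 'X_[_]; apply/mnmP => j; rewrite emon_nth mnm1E nth_unit.
Qed.

Lemma xvalX f n : xval (xexp f n) = xval f ^+ n.
Proof.
elim: n => [|n IHn]; first by rewrite xval_cst pval_cst zval1 mpolyC1.
by rewrite /xexp iterS xvalM IHn exprS.
Qed.

Lemma mcoeff_xval f g : (xval f)@_(emon 8 g) = pval (xcoef (esame 8 g) f).
Proof.
rewrite (fval_coef pvalD) ?pval_nil // /xval /fval raddf_sum /=.
rewrite [RHS]big_mkcond; apply: eq_bigr => x _.
by rewrite mcoeffCM mcoeffX eq_sym emonE; case: esame; rewrite ?mulr1 ?mulr0.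
Qed.

(** A value of type [xpoly] also serves as a linear form: its keys are then
    the exponents e of the unknown coefficients c e. *)
Section LinearForms.
Variable c : expo -> F.

Definition rval (r : xpoly) : F := fval pval c r.

Lemma rvalD r s : rval (xadd r s) = rval r + rval s.
Proof. exact: fval_add pvalD pval_nil r s. Qed.

Lemma rval_scale p r : rval (xscale p r) = pval p * rval r.
Proof. exact: fval_scale pvalM p r. Qed.

End LinearForms.
End Values.

(** * Elimination with integer pivots *)

(** Only nonzero integers are accepted as pivots: they remain invertible for
    all values of the parameters. *)
Definition int_pivot (p : ppoly) : option Z :=
  if p is [:: ([::], z)] then if Z.eqb Z0 z then None else Some z else None.

Fixpoint row_pivot (r s : xpoly) : option (expo * Z) :=
  if s is x :: s' then
    if int_pivot (xcoef (pred1 x.1) r) is Some z then Some (x.1, z)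
    else row_pivot r s'
  else None.

Fixpoint find_pivot (rows : seq xpoly) : option (expo * Z * xpoly) :=
  if rows is r :: rows' then
    if row_pivot r r is Some jz then Some (jz, r) else find_pivot rows'
  else None.

Definition reduce (j : expo) (z : Z) (r s : xpoly) : xpoly :=
  let c := xcoef (pred1 j) s in
  if nilp c then s else xadd (xscale (pcst z) s) (xscale (popp c) r).

(** The unknowns that n elimination steps show to vanish. Starting with the
    shortest rows avoids fill-in, and with it pivots that involve the
    parameters. *)
Fixpoint forced (n : nat) (rows : seq xpoly) : seq expo :=
  if n is n'.+1 then
    let rows' := sort (fun r s => size r <= size s)%N rows in
    if find_pivot rows' is Some (j, z, r) then
      let zeros :=
        forced n' [seq s <- [seq reduce j z r s | s <- rows'] | ~~ nilp s] in
      if all (fun x => (x.1 == j) || (x.1 \in zeros)) r then j :: zeros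
      else zeros
    else [::]
  else [::].

Section Soundness.
Variables (F : fieldType) (a : seq F) (c : expo -> F).
Hypothesis F0 : [pchar F] =i pred0.

Lemma zval_eq0 z : (zval F z == 0) = Z.eqb Z0 z.
Proof.
have N n : (n%:R == 0 :> F) = (n == 0%N) by rewrite (pcharf0P F).1.
rewrite -[in RHS](int_of_ZK z) /zval.
case: (int_of_Z z) => n; rewrite ?NegzE ?mulrNz ?oppr_eq0 -pmulrn N.
  by case: n.
by rewrite /= addn1.
Qed.

Lemma int_pivotP p z : int_pivot p = Some z -> pval a p != 0.
Proof.
case: p => [|[[|??] z'] [|??]] //; rewrite /int_pivot; case: ifP => // z'0 _.
by rewrite -[[:: _]]/(pcst z') pval_cst zval_eq0 z'0.
Qed.

Lemma find_pivotP rows j z r : find_pivot rows = Some (j, z, r) ->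
  r \in rows /\ pval a (xcoef (pred1 j) r) != 0.
Proof.
elim: rows => //= r' rows IHrows.
case E: (row_pivot r' r') => [jz|]; last first.
  by move/IHrows => [rin nz]; rewrite inE rin orbT.
case=> ? ?; subst jz r'; rewrite mem_head; split=> //.
elim: {2}r E => //= x s IHs; case E: (int_pivot _) => [z'|] //.
by case=> <- _; exact: int_pivotP E.
Qed.

(** The reduced rows are linear combinations of the given ones, hence vanish
    as well; if they force all unknowns of the pivot row but the pivot to be
    zero, then so is the pivot. *)
Lemma forcedP n rows :
  (forall r, r \in rows -> rval a c r = 0) ->
  forall e, e \in forced n rows -> c e = 0.
Proof.
elim: n rows => //= n IHn rows rows0.
set rows' := sort _ rows.
have{rows0} rows'0 r : r \in rows' -> rval a c r = 0.
  by rewrite mem_sort; apply: rows0.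
case E: (find_pivot rows') => [[[j z] r]|//].
have [rin nz] := find_pivotP E.
set zeros := forced n _.
have zerosP e : e \in zeros -> c e = 0.
  apply: IHn => s; rewrite mem_filter => /andP[_ /mapP[r' r'in ->]].
  rewrite /reduce; case: ifP => _; first exact: rows'0.
  by rewrite rvalD !rval_scale !rows'0 // !mulr0 addr0.
case: ifP => // /allP rP e; rewrite inE => /predU1P[->|]; last exact: zerosP.
have/eqP := rows'0 r rin; rewrite /rval /fval (bigID (fun x => pred1 j x.1)) /=.
rewrite [X in _ + X]big_seq_cond [X in _ + X]big1 ?addr0; last first.
  by move=> x /andP[/rP/orP[->//|/zerosP->]]; rewrite mulr0.
rewrite (eq_bigr (fun x => pval a x.2 * c j)) => [|x /eqP->//].
rewrite -mulr_suml.
have nil0 : pval a [::] = 0 by exact: pval_nil.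
rewrite -[X in X * _ == _](fval_coef (@pvalD F a) (pred1 j) r nil0).
by rewrite mulf_eq0 (negPf nz) => /eqP.
Qed.

End Soundness.

(** * The equations that express the absence of poles *)

Fixpoint exps (n d : nat) : seq expo :=
  if n is n'.+1 then
    flatten [seq [seq k :: e | e <- exps n' (d - k)] | k <- iota 0 d.+1]
  else [:: [::]].

Arguments exps : simpl never.

Lemma expsS n d :
  exps n.+1 d = [seq k :: e | k <- iota 0 d.+1, e <- exps n (d - k)].
Proof. by []. Qed.

Lemma mem_exps n d e : (e \in exps n d) = (size e == n) && (sumn e <= d)%N.
Proof.
elim: n d e => [|n IHn] d e; first by case: e.
rewrite expsS; apply/allpairsPdep/idP => [[k [f []]]|].
  rewrite mem_iota add0n ltnS IHn /= => kd /andP[/eqP sf fd ->] /=.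
  by rewrite sf eqxx -leq_subRL.
case: e => // k e; rewrite [size _]/= [sumn _]/= eqSS => /andP[se ed].
exists k, e; split=> //.
  by rewrite mem_iota ltnS (leq_trans (leq_addr _ _) ed).
by rewrite IHn se leq_subRL // (leq_trans (leq_addr _ _) ed).
Qed.

Lemma uniq_exps n d : uniq (exps n d).
Proof.
elim: n d => // n IHn d; rewrite expsS.
apply: allpairs_uniq_dep; [exact: iota_uniq | by move=> k _; exact: IHn |].
by move=> [k e] [k' e'] _ _ /= [-> ->].
Qed.

Lemma emon_inj n : {in [pred e | size e == n] &, injective (emon n)}.
Proof.
move=> e f /eqP se /eqP sf /eqP; rewrite emonE => /esameP ef.
apply: (@eq_from_nth _ 0%N) => [|i]; first by rewrite se.
by rewrite se; apply: ef.
Qed.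

Lemma sumn_nth n e : size e = n -> sumn e = (\sum_(i < n) nth 0 e i)%N.
Proof. by move=> <-; rewrite sumnE (big_nth 0%N) big_mkord. Qed.

Lemma msupp_exps n d (A : nzRingType) (K : {mpoly A[n]}) m :
  (msize K <= d.+1)%N -> m \in msupp K ->
  exists2 e, e \in exps n d & m = emon n e.
Proof.
move=> Kd mK; exists [seq m i | i <- enum 'I_n]; last first.
  apply/mnmP => i.
  by rewrite emon_nth (nth_map i) ?size_enum_ord // nth_ord_enum.
rewrite mem_exps size_map size_enum_ord eqxx /=.
rewrite sumnE big_map big_enum /= -mdegE -ltnS.
exact: leq_trans (msize_mdeg_lt mK) Kd.
Qed.

Lemma mmap_exps n d (A : comNzRingType) (F : fieldType)
    (h : {rmorphism F -> A}) (s : 'I_n -> A) (K : {mpoly F[n]}) :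
  (msize K <= d.+1)%N ->
  mmap h s K = \sum_(e <- exps n d)
    h K@_(emon n e) * \prod_(i < n) s i ^+ nth 0 e i.
Proof.
move=> Kd; rewrite /mmap.
rewrite (perm_big [seq emon n e | e <- exps n d & emon n e \in msupp K]) /=.
  rewrite big_map big_filter big_mkcond; apply: eq_bigr => e _ /=.
  case: ifP => [_|/negbT/memN_msupp_eq0 ->]; last by rewrite rmorph0 mul0r.
  by congr (_ * _); apply: eq_bigr => i _; rewrite emon_nth.
apply: uniq_perm; first exact: msupp_uniq.
  rewrite map_inj_in_uniq ?filter_uniq ?uniq_exps // => e f.
  rewrite !mem_filter !mem_exps => /and3P[_ se _] /and3P[_ sf _].
  exact: emon_inj.
move=> m; apply/idP/mapP => [mK|[e]].
  have [e e_in em] := msupp_exps Kd mK; exists e => //.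
  by rewrite mem_filter -em mK.
by rewrite mem_filter => /andP[? _] ->.
Qed.

Lemma mcoeff_mulXn_eq0 n (A : nzRingType) (p : {mpoly A[n]}) (i : 'I_n)
    (k : nat) (m : 'X_{1..n}) :
  (m i < k)%N -> (p * 'X_i ^+ k)@_m = 0.
Proof.
move=> mk; apply/eqP; rewrite mpolyXn mcoeff_eq0 (perm_mem (msuppMX _ _)).
apply/mapP => -[m' _ mE]; move: mk.
by rewrite mE mnmDE mulmnE mnm1E eqxx mul1n ltnNge leq_addr.
Qed.

(** In every chart the old coordinates have poles of order at most two in the
    inverted coordinate and numerical denominators dividing eight. *)
Definition den (v : nat) : xpoly := (xnat 8 * xvar v ^+ 2)%xpoly.

Arguments den : simpl never.

Definition subst_mon (N : seq xpoly) (D : xpoly) (e : expo) : xpoly :=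
  foldr (fun x h => xmul (xexp x.1 x.2) h) (xexp D (3 - sumn e)) (zip N e).

(** One row for each monomial g of degree less than 6 in the coordinate v: its
    entry at e is the coefficient of g in D^(3 - |e|) N^e. *)
Definition chart_rows (v : nat) (N : seq xpoly) : seq xpoly :=
  let T := [seq (e, subst_mon N (den v) e) | e <- exps 8 3] in
  let G := undup (flatten
    [seq [seq x.1 | x <- et.2 & (nth 0 x.1 v < 6)%N] | et <- T]) in
  [seq [seq r <- [seq (et.1, xcoef (esame 8 g) et.2) | et <- T] | ~~ nilp r.2]
  | g <- G].

Section PoleEquations.
Variables (F L : fieldType) (emb : {rmorphism {mpoly F[8]} -> L}) (a : seq F).
Hypothesis emb_inj : injective emb.

Lemma xval_subst_mon N D e :
  xval a (subst_mon N D e) =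
  xval a D ^+ (3 - sumn e) * \prod_(x <- zip N e) xval a x.1 ^+ x.2.
Proof.
rewrite /subst_mon; elim: zip => [|x s IHs] /=.
  by rewrite big_nil mulr1 xvalX.
by rewrite xvalM xvalX IHs big_cons mulrCA.
Qed.

(** If the expression of K is a polynomial P, then D^3 P is divisible by the
    sixth power of the inverted coordinate; expanding K on the other side of
    D^3 K(s) = D^3 P gives the equations. *)
Lemma chart_rowsP (v : 'I_8) (N : seq xpoly) (s : 8.-tuple L)
    (K P : {mpoly F[8]}) :
  size N = 8 ->
  (forall i : 'I_8,
     emb (xval a (den v)) * tnth s i = emb (xval a (nth [::] N i))) ->
  (msize K <= 4)%N ->
  mmap (emb \o @mpolyC 8 F) (tnth s) K = emb P ->
  forall r, r \in chart_rows v N -> rval a (fun e => K@_(emon 8 e)) r = 0.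
Proof.
move=> sN sE K4 KP.
pose D := xval a (den v).
pose T := [seq (e, subst_mon N (den v) e) | e <- exps 8 3].
have cleared : D ^+ 3 * P =
    \sum_(et <- T) (K@_(emon 8 et.1))%:MP * xval a et.2.
  apply: emb_inj.
  rewrite rmorphM /= -KP (@mmap_exps 8 3 _ _ (emb \o @mpolyC 8 F)) //.
  rewrite mulr_sumr rmorph_sum big_map /= !big_seq; apply: eq_bigr => e.
  rewrite mem_exps => /andP[/eqP se sume].
  rewrite mulrCA [in RHS]rmorphM; congr (_ * _).
  have -> : D ^+ 3 = D ^+ (3 - sumn e) * D ^+ sumn e by rewrite -exprD subnK.
  rewrite xval_subst_mon [in RHS]rmorphM [in LHS]rmorphM -mulrA.
  congr (_ * _); rewrite (sumn_nth se) -prodrXr !rmorph_prod -big_split /=.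
  rewrite (big_nth ([::], 0%N)) size_zip sN se big_mkord.
  apply: eq_bigr => i _; rewrite nth_zip ?sN ?se //= !rmorphXn -exprMn.
  by rewrite sE.
have low g : (nth 0 g v < 6)%N -> (D ^+ 3 * P)@_(emon 8 g) = 0.
  move=> gv; rewrite /D /den xvalM xval_nat xvalX xval_var -mulrC exprMn.
  by rewrite -exprM mulrA; apply: mcoeff_mulXn_eq0; rewrite emon_nth.
move=> r /mapP[g g_in ->{r}]; rewrite -/T in g_in *.
have gv : (nth 0 g v < 6)%N.
  move: g_in; rewrite mem_undup => /flattenP[_ /mapP[et _ ->] /mapP[x]].
  by rewrite mem_filter => /andP[? _] ->.
rewrite -(low g gv) cleared raddf_sum /rval /fval big_filter big_mkcond big_map.
apply: eq_bigr => -[e f] _ /=; rewrite mcoeffCM mcoeff_xval mulrC.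
by case: ifP => // /negbFE/nilP->; rewrite /pval fval_nil mulr0.
Qed.

Lemma emb_var_neq0 i : emb 'X_i != 0.
Proof.
rewrite -(rmorph0 emb) (inj_eq emb_inj); apply/eqP.
move=> /(congr1 (mcoeff U_(i))) /eqP.
by rewrite mcoeffX mcoeff0 eqxx oner_eq0.
Qed.

Lemma emb_nat_neq0 n : [pchar F] =i pred0 -> n.+1%:R != 0 :> L.
Proof.
move=> F0; rewrite -(rmorph_nat emb) -(rmorph0 emb) (inj_eq emb_inj).
by rewrite -mpolyC_nat mpolyC_eq0 (pcharf0P F).1.
Qed.

End PoleEquations.

(** * The five charts *)

(** The lists below are the entries of the inverse charts, multiplied by the
    common denominator [den]. *)
Section Numerators.
Let x := xvar i_q1.
Let y := xvar i_p1.
Let z := xvar i_q2.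
Let w := xvar i_p2.
Let l := xvar i_q3.
Let m := xvar i_p3.
Let n := xvar i_q4.
Let u := xvar i_p4.
Let a0 := xpar 0.
Let a1 := xpar 1.
Let a3 := xpar 2.
Let a4 := xpar 3.
Let t := xpar 4.
Let a2 := (xnat 1 - a0 - a1 - a3 - a4)%xpoly.
Local Open Scope xpoly_scope.

Definition num0 : seq xpoly :=
  let d f := den i_q1 * f in
  [:: xnat 8 * x; - d ((y * x + a0) * x) - xnat 2 * x ^+ 2 * z ^+ 2;
      d z; d w - xnat 4 * x * z; d l; d m; d n; d u].

Definition num1 : seq xpoly :=
  let d f := den i_q2 * f in
  [:: d x; d y; xnat 8 * z; - d ((w * z + a1) * z); d l; d m; d n; d u].

Definition num2 : seq xpoly :=
  let d f := den i_q2 * f in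
  (* These are 2 z q1, z q3 and 2 z q4 for the old coordinates q1, q3, q4. *)
  let q1 := xnat 2 * z * x + xnat 1 in
  let q3 := z * l + xnat 1 in
  let q4 := xnat 2 * z * n + xnat 1 in
  let p3 := d m + xnat 2 - xnat 2 * q4 in
  [:: xnat 4 * z * q1; d y - xnat 2; xnat 8 * z;
      - (d ((w * z + a2) * z) + xnat 4 * z ^+ 2 * (y + u) - xnat 4 * q3
         + p3 + d t + xnat 2 * q1 + xnat 2 * q3 * q4);
      xnat 8 * z * q3; p3; xnat 4 * z * q4; d u - xnat 4 * q3 + xnat 2].

Definition num3 : seq xpoly :=
  let d f := den i_q3 * f in
  [:: d x; d y; d z; d w; xnat 8 * l; - d ((m * l + a3) * l); d n; d u].

Definition num4 : seq xpoly :=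
  let d f := den i_q4 * f in
  [:: d x; d y; d z; d w; d l; d m - xnat 4 * n * l; xnat 8 * n;
     - d ((u * n + a4) * n) - xnat 2 * n ^+ 2 * l ^+ 2].

End Numerators.

Definition all_rows : seq xpoly :=
  chart_rows i_q1 num0 ++ chart_rows i_q2 num1 ++ chart_rows i_q2 num2
  ++ chart_rows i_q3 num3 ++ chart_rows i_q4 num4.

(** There are 165 exponents of degree at most 3 in eight variables, and the
    rows do not involve the zero exponent: 164 steps suffice. *)
Lemma elimination :
  let zeros := forced 164 all_rows in
  all (fun e => (e \in zeros) || (e == nseq 8 0%N)) (exps 8 3).
Proof. by vm_cast_no_check (erefl true). Qed.

Lemma ord8_ind (P : 'I_8 -> Prop) :
  P i_q1 -> P i_p1 -> P i_q2 -> P i_p2 -> P i_q3 -> P i_p3 -> P i_q4 -> P i_p4 ->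
  forall i, P i.
Proof.
move=> P1 P2 P3 P4 P5 P6 P7 P8.
case=> [[|[|[|[|[|[|[|[|k]]]]]]]] ltk8] //;
  by rewrite (bool_irrelevance ltk8 isT).
Qed.

Section Regularity.
Variables (A : comPzRingType) (L : fieldType) (emb : {rmorphism A -> L}).

Definition regular (f : L) := exists P : A, f = emb P.

Lemma regularD f g : regular f -> regular g -> regular (f + g).
Proof. by case=> P -> [Q ->]; exists (P + Q); rewrite rmorphD. Qed.

Lemma regularN f : regular f -> regular (- f).
Proof. by case=> P ->; exists (- P); rewrite rmorphN. Qed.

Lemma regularM f g : regular f -> regular g -> regular (f * g).
Proof. by case=> P -> [Q ->]; exists (P * Q); rewrite rmorphM. Qed.

Lemma regularX f n : regular f -> regular (f ^+ n).
Proof. by case=> P ->; exists (P ^+ n); rewrite rmorphXn. Qed.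

Lemma regular_nat n : regular n%:R.
Proof. by exists n%:R; rewrite rmorph_nat. Qed.

End Regularity.

(** Of the rational functions only the embedding of the polynomials into a
    field matters for the identities between the charts and their numerators. *)
Section Uniqueness.
Variables (F L : fieldType) (emb : {rmorphism {mpoly F[8]} -> L}).
Hypothesis emb_inj : injective emb.
Hypothesis F0 : [pchar F] =i pred0.
Variables a0 a1 a2 a3 a4 t : F.
Hypothesis a_sum : a0 + a1 + a2 + a3 + a4 = 1.
Let a := [:: a0; a1; a3; a4; t].
Let C (c : F) : L := emb c%:MP.
Let X : 8.-tuple L := [tuple emb 'X_i | i < 8].
Let V i := emb 'X_i.
Let Q f := emb (xval a f).

Let QD f g : Q (xadd f g) = Q f + Q g.
Proof. by rewrite /Q xvalD rmorphD. Qed.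

Let QM f g : Q (xmul f g) = Q f * Q g.
Proof. by rewrite /Q xvalM rmorphM. Qed.

Let QN f : Q (xopp f) = - Q f.
Proof. by rewrite /Q xvalN rmorphN. Qed.

Let QX f n : Q (xexp f n) = Q f ^+ n.
Proof. by rewrite /Q xvalX rmorphXn. Qed.

Let Qnat n : Q (xnat n) = n%:R.
Proof. by rewrite /Q xval_nat rmorph_nat. Qed.

Let Qpar i : (i < 5)%N -> Q (xpar i) = C a`_i.
Proof. by move=> i5; rewrite /Q xval_cst pval_var. Qed.

Let Qvar (i : 'I_8) : Q (xvar i) = V i.
Proof. by rewrite /Q xval_var. Qed.

Let C2 : C a2 = 1 - C a0 - C a1 - C a3 - C a4.
Proof.
by rewrite -(rmorph1 emb) -mpolyC1 -a_sum /C !(mpolyCD, rmorphD) /=; ring.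
Qed.

Let V_neq0 i : V i != 0.
Proof. exact: emb_var_neq0. Qed.

Let L_nat_neq0 n : n.+1%:R != 0 :> L.
Proof. exact: (emb_nat_neq0 emb_inj). Qed.

Let Qparams := (@Qpar 0 isT, @Qpar 1 isT, @Qpar 2 isT, @Qpar 3 isT, @Qpar 4 isT).
Let Qvars := (Qvar i_q1, Qvar i_p1, Qvar i_q2, Qvar i_p2,
              Qvar i_q3, Qvar i_p3, Qvar i_q4, Qvar i_p4).

Ltac clear_denominators N :=
  elim/ord8_ind; rewrite (tnth_nth 0) /app8 !tnth_mktuple
    -/(V i_q1) -/(V i_p1) -/(V i_q2) -/(V i_p2)
    -/(V i_q3) -/(V i_p3) -/(V i_q4) -/(V i_p4)
    [nth _ (tval _) _]/= /N [nth _ _ _]/= /den;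
  rewrite !(QD, QM, QN, QX, Qnat) ?Qparams ?C2 ?Qvars;
  field; rewrite ?V_neq0 ?L_nat_neq0.

Lemma num0P (i : 'I_8) :
  Q (den i_q1) * tnth (app8 (s0 (C a0)) X) i = Q (nth [::] num0 i).
Proof. by move: i; clear_denominators num0. Qed.

Lemma num1P (i : 'I_8) :
  Q (den i_q2) * tnth (app8 (s1 (C a1)) X) i = Q (nth [::] num1 i).
Proof. by move: i; clear_denominators num1. Qed.

Lemma num2P (i : 'I_8) :
  Q (den i_q2) * tnth (app8 (s2 (C t) (C a2)) X) i = Q (nth [::] num2 i).
Proof. by move: i; clear_denominators num2. Qed.

Lemma num3P (i : 'I_8) :
  Q (den i_q3) * tnth (app8 (s3 (C a3)) X) i = Q (nth [::] num3 i).
Proof. by move: i; clear_denominators num3. Qed.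

Lemma num4P (i : 'I_8) :
  Q (den i_q4) * tnth (app8 (s4 (C a4)) X) i = Q (nth [::] num4 i).
Proof. by move: i; clear_denominators num4. Qed.

Local Opaque chart_rows forced.
Notation expr s K := (mmap (emb \o @mpolyC 8 F) (tnth s) K).

(** The Hamiltonian G of the statement, which is regular in the four other
    charts, is excluded by the third one. *)
Lemma regular_cubic_const (K : {mpoly F[8]}) : (msize K <= 4)%N ->
  regular emb (expr (app8 (s0 (C a0)) X) K) ->
  regular emb (expr (app8 (s1 (C a1)) X) K) ->
  regular emb (expr (app8 (s2 (C t) (C a2)) X) K) ->
  regular emb (expr (app8 (s3 (C a3)) X) K) ->
  regular emb (expr (app8 (s4 (C a4)) X) K) ->
  K = (K@_(0%MM))%:MP.
Proof.
move=> K4 [P0 E0] [P1 E1] [P2 E2] [P3 E3] [P4 E4].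
pose c e := K@_(emon 8 e).
have rows0 r : r \in all_rows -> rval a c r = 0.
  rewrite /all_rows.
  rewrite mem_cat => /orP[r_in|].
    exact: (chart_rowsP emb_inj (erefl : size num0 = 8) num0P K4 E0 r_in).
  rewrite mem_cat => /orP[r_in|].
    exact: (chart_rowsP emb_inj (erefl : size num1 = 8) num1P K4 E1 r_in).
  rewrite mem_cat => /orP[r_in|].
    exact: (chart_rowsP emb_inj (erefl : size num2 = 8) num2P K4 E2 r_in).
  rewrite mem_cat => /orP[r_in|].
    exact: (chart_rowsP emb_inj (erefl : size num3 = 8) num3P K4 E3 r_in).
  exact: (chart_rowsP emb_inj (erefl : size num4 = 8) num4P K4 E4).
apply/mpolyP => m; rewrite mcoeffC.
have [->|m0] := eqVneq m 0%MM; first by rewrite mulr1.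
rewrite mulr0.
have [mK|/memN_msupp_eq0//] := boolP (m \in msupp K).
have [e e_in em] := msupp_exps K4 mK.
have := allP elimination e e_in; case/orP.
  by rewrite em; exact: (forcedP F0 rows0).
move=> /eqP e0; case/eqP: m0; rewrite em e0.
by apply/mnmP => i; rewrite emon_nth mnm0E nth_nseq if_same.
Qed.

End Uniqueness.

(** * The Hamiltonian of the target system *)

(** The target Hamiltonian and vector field over an arbitrary ring, with h in
    the place of 3/2: they are evaluated at polynomials as well as at rational
    functions. *)
Section Hamiltonian.
Variable A : comPzRingType.
Implicit Types (q p t a h : A).

Definition halfham q1 p1 q2 p2 t a0 a1 : A :=
  2%:R * (q1 ^+ 2 * p1 + p1 ^+ 2 + t * p1 + a0 * q1)
  + q2 ^+ 2 * p2 - 2%:R * p2 ^+ 2 + a1 * q2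
  + 4%:R * p1 * p2 - 2%:R * q1 * q2 * p2.

Definition ham h t a0 a1 a3 a4 q1 p1 q2 p2 q3 p3 q4 p4 : A :=
  halfham q1 p1 q2 p2 t a0 a1 + halfham q4 p4 q3 p3 t a4 a3
  - h * p1 ^+ 2 - h * p4 ^+ 2 + 3%:R * p1 * p4.

Definition flow t a0 a1 a3 a4 q1 p1 q2 p2 q3 p3 q4 p4 : 8.-tuple A :=
  [tuple
    2%:R * q1 ^+ 2 + p1 + 2%:R * t + 4%:R * p2 + 3%:R * p4;
    - 4%:R * q1 * p1 + 2%:R * q2 * p2 - 2%:R * a0;
    q2 ^+ 2 - 4%:R * p2 + 4%:R * p1 - 2%:R * q1 * q2;
    - 2%:R * q2 * p2 + 2%:R * q1 * p2 - a1;
    q3 ^+ 2 - 4%:R * p3 + 4%:R * p4 - 2%:R * q3 * q4;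
    - 2%:R * q3 * p3 + 2%:R * q4 * p3 - a3;
    2%:R * q4 ^+ 2 + p4 + 2%:R * t + 3%:R * p1 + 4%:R * p3;
    - 4%:R * q4 * p4 + 2%:R * q3 * p3 - 2%:R * a4].

(** The chain rule for a derivation D gives all eight partial derivatives at
    once. *)
Lemma derivation_ham (D : A -> A) h t a0 a1 a3 a4 q1 p1 q2 p2 q3 p3 q4 p4 :
  {morph D : x y / x + y} -> (forall x y, D (x * y) = D x * y + x * D y) ->
  h * 2%:R = 3%:R -> D h = 0 -> D t = 0 ->
  [/\ D a0 = 0, D a1 = 0, D a3 = 0 & D a4 = 0] ->
  let f := tnth (flow t a0 a1 a3 a4 q1 p1 q2 p2 q3 p3 q4 p4) in
  D (ham h t a0 a1 a3 a4 q1 p1 q2 p2 q3 p3 q4 p4) =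
    f i_q1 * D p1 - f i_p1 * D q1 + f i_q2 * D p2 - f i_p2 * D q2
    + f i_q3 * D p3 - f i_p3 * D q3 + f i_q4 * D p4 - f i_p4 * D q4.
Proof.
move=> DD DM h2 Dh Dt [Da0 Da1 Da3 Da4] /=; rewrite !(tnth_nth 0) /=.
have D0 : D 0 = 0 by apply: (addrI (D 0)); rewrite -DD !addr0.
have DN x : D (- x) = - D x by apply: (addrI (D x)); rewrite -DD !subrr.
have Dn n : D n%:R = 0.
  elim: n => [//|n IHn]; rewrite -addn1 natrD DD IHn add0r.
  by apply: (addrI (D 1)); rewrite addr0 -{3}[1]mulr1 DM mulr1 mul1r.
have Dsq x : D (h * x ^+ 2) = 3%:R * x * D x.
  by rewrite DM Dh -h2 expr2 DM; ring.
rewrite /ham /halfham !(DD, DN) !Dsq.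
rewrite !(DM, DD, DN, Dn, Dt, Da0, Da1, Da3, Da4, expr2).
ring.
Qed.

End Hamiltonian.

Lemma mderiv_var n (F : comNzRingType) (i j : 'I_n) :
  ('X_i)^`M(j) = (i == j)%:R :> {mpoly F[n]}.
Proof.
rewrite mderivX mnm1E; case: eqP => [->|_]; last by rewrite scale0r.
rewrite scale1r (_ : (_ - _)%MM = 0%MM) ?mpolyX0 //.
by apply/mnmP => k; rewrite mnmBE subnn mnm0E.
Qed.

Lemma mderiv_addC n (F : nzRingType) (p : {mpoly F[n]}) c j :
  (p + c%:MP)^`M(j) = p^`M(j).
Proof. by rewrite mderivD mderivC addr0. Qed.

Lemma mderiv_ham (F : fieldType) (t a0 a1 a3 a4 : F) : 2%:R != 0 :> F ->
  let H := ham (3%:R / 2%:R)%:MP t%:MP a0%:MP a1%:MP a3%:MP a4%:MP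
    'X_i_q1 'X_i_p1 'X_i_q2 'X_i_p2 'X_i_q3 'X_i_p3 'X_i_q4 'X_i_p4 in
  [tuple H^`M(i_p1); - H^`M(i_q1); H^`M(i_p2); - H^`M(i_q2);
         H^`M(i_p3); - H^`M(i_q3); H^`M(i_p4); - H^`M(i_q4)] =
  flow t%:MP a0%:MP a1%:MP a3%:MP a4%:MP
    'X_i_q1 'X_i_p1 'X_i_q2 'X_i_p2 'X_i_q3 'X_i_p3 'X_i_q4 'X_i_p4
  :> 8.-tuple {mpoly F[8]}.
Proof.
move=> F2.
have half : (3%:R / 2%:R)%:MP * 2%:R = 3%:R :> {mpoly F[8]}.
  by rewrite -[X in _ * X]mpolyC_nat -mpolyCM divfK ?mpolyC_nat.
have DE j := @derivation_ham _ (mderiv j) _ _ _ _ _ _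
  'X_i_q1 'X_i_p1 'X_i_q2 'X_i_p2 'X_i_q3 'X_i_p3 'X_i_q4 'X_i_p4
  (@mderivD _ _ j) (@mderivM _ _ j) half (mderivC j _) (mderivC j t)
  (And4 (mderivC j a0) (mderivC j a1) (mderivC j a3) (mderivC j a4)).
move=> H; have HE j : H^`M(j) = _ := DE j.
move: HE; move: (flow _ _ _ _ _ _ _ _ _ _ _ _ _) => f HE.
have one (i : 'I_8) : ('X_i)^`M(i) = 1 :> {mpoly F[8]}.
  by rewrite mderiv_var eqxx.
have zero (i j : 'I_8) : i != j -> ('X_i)^`M(j) = 0 :> {mpoly F[8]}.
  by rewrite mderiv_var => /negPf->.
apply: eq_from_tnth; elim/ord8_ind;
  rewrite [LHS](tnth_nth 0) [LHS]/= HE one !zero //;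
  by rewrite !(mulr0, mulr1, oppr0, subr0, add0r, addr0, sub0r, opprK).
Qed.

Lemma rmorph_ham (A B : comPzRingType) (phi : {rmorphism A -> B})
    h t a0 a1 a3 a4 q1 p1 q2 p2 q3 p3 q4 p4 :
  phi (ham h t a0 a1 a3 a4 q1 p1 q2 p2 q3 p3 q4 p4) =
  ham (phi h) (phi t) (phi a0) (phi a1) (phi a3) (phi a4)
    (phi q1) (phi p1) (phi q2) (phi p2) (phi q3) (phi p3) (phi q4) (phi p4).
Proof.
by rewrite /ham /halfham !expr2 !(rmorphD, rmorphN, rmorphM, rmorph_nat)
  !rmorph1.
Qed.

Section HamiltonianInCharts.
Variable L : fieldType.
Hypothesis nat_neq0 : forall n, n.+1%:R != 0 :> L.
Variables (A : comPzRingType) (emb : {rmorphism A -> L}).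
Local Notation regular := (regular emb).
Hypothesis regularV : forall k, regular k%:R^-1.
Variables (t a0 a1 a2 a3 a4 x y z w l m n u : L).
Hypotheses (rt : regular t) (ra0 : regular a0) (ra1 : regular a1)
  (ra2 : regular a2) (ra3 : regular a3) (ra4 : regular a4) (rx : regular x)
  (ry : regular y) (rz : regular z) (rw : regular w) (rl : regular l)
  (rm : regular m) (rn : regular n) (ru : regular u).
Let G := ham (3%:R / 2%:R) t a0 a1 a3 a4.

Ltac expand_ham nz :=
  rewrite /G /app8 !(tnth_nth 0) /= /ham /halfham;
  field; rewrite ?nz ?nat_neq0.

Ltac regular :=
  rewrite /halfham; repeat first
  [ assumption | apply: regular_nat | apply: regularV
  | apply: regularD | apply: regularN | apply: regularM | apply: regularX ].

(** The poles of 2 q1 (q1 p1 + a0) = - 2 y - z^2 / (2 x^2) cancel against those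
    of the terms that contain p2 = w - z / (2 x). *)
Lemma ham_chart0 : x != 0 ->
  app8 G (s0 a0 x y z w l m n u) =
  let p := - (y * x + a0) * x - z ^+ 2 / 4%:R in
  2%:R * (p ^+ 2 + t * p - y) + z ^+ 2 * w - 2%:R * w ^+ 2 + a1 * z
  + 4%:R * p * w + 2%:R * z * (y * x + a0) + halfham n u l m t a4 a3
  - (3%:R / 2%:R) * p ^+ 2 - (3%:R / 2%:R) * u ^+ 2 + 3%:R * p * u.
Proof. by move=> nz; expand_ham nz. Qed.

(** Here q2^2 p2 + a1 q2 = - w, and q2 p2 = - (w z + a1). *)
Lemma ham_chart1 : z != 0 ->
  app8 G (s1 a1 x y z w l m n u) =
  let p := - (w * z + a1) * z in
  2%:R * (x ^+ 2 * y + y ^+ 2 + t * y + a0 * x) - w - 2%:R * p ^+ 2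
  + 4%:R * y * p + 2%:R * x * (w * z + a1) + halfham n u l m t a4 a3
  - (3%:R / 2%:R) * y ^+ 2 - (3%:R / 2%:R) * u ^+ 2 + 3%:R * y * u.
Proof. by move=> nz; expand_ham nz. Qed.

(** The pole of the expression of the Hamiltonian itself is
    (a0 + a1 + a2 + a3 + a4) / z, which cancels against 1 / z. *)
Lemma ham_chart2 : z != 0 -> a0 + a1 + a2 + a3 + a4 = 1 ->
  app8 G (s2 t a2 x y z w l m n u) - z^-1 =
  let v := (w * z + a2) * z in
  2%:R * x * (x * y + a0) - 2%:R * v ^+ 2
  - v * (6%:R * y + 2%:R * l * n + 4%:R * m + 2%:R * u + 4%:R * t)
  - y * (2%:R * y + 3%:R * l * n + 6%:R * m + 4%:R * t)
  + w + l * (w * z + a2 + a3) + l ^+ 2 * m - l ^+ 2 * n ^+ 2 / 2%:R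
  - 4%:R * l * m * n - l * n * (u + 2%:R * t)
  - 4%:R * m * (m + t) + 2%:R * m * u + 2%:R * n * (n * u + a4)
  - 2%:R * t ^+ 2.
Proof.
move=> nz a_sum; have ->: a2 = 1 - a0 - a1 - a3 - a4 by rewrite -a_sum; ring.
by expand_ham nz.
Qed.

Lemma ham_chart3 : l != 0 ->
  app8 G (s3 a3 x y z w l m n u) =
  let p := - (m * l + a3) * l in
  2%:R * (n ^+ 2 * u + u ^+ 2 + t * u + a4 * n) - m - 2%:R * p ^+ 2
  + 4%:R * u * p + 2%:R * n * (m * l + a3) + halfham x y z w t a0 a1
  - (3%:R / 2%:R) * y ^+ 2 - (3%:R / 2%:R) * u ^+ 2 + 3%:R * y * u.
Proof. by move=> nz; expand_ham nz. Qed.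

Lemma ham_chart4 : n != 0 ->
  app8 G (s4 a4 x y z w l m n u) =
  let p := - (u * n + a4) * n - l ^+ 2 / 4%:R in
  2%:R * (p ^+ 2 + t * p - u) + l ^+ 2 * m - 2%:R * m ^+ 2 + a3 * l
  + 4%:R * p * m + 2%:R * l * (u * n + a4) + halfham x y z w t a0 a1
  - (3%:R / 2%:R) * y ^+ 2 - (3%:R / 2%:R) * p ^+ 2 + 3%:R * y * p.
Proof. by move=> nz; expand_ham nz. Qed.

Lemma regular_chart0 : x != 0 -> regular (app8 G (s0 a0 x y z w l m n u)).
Proof. by move=> nz; rewrite ham_chart0 //; regular. Qed.

Lemma regular_chart1 : z != 0 -> regular (app8 G (s1 a1 x y z w l m n u)).
Proof. by move=> nz; rewrite ham_chart1 //; regular. Qed.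

Lemma regular_chart2 : z != 0 -> a0 + a1 + a2 + a3 + a4 = 1 ->
  regular (app8 G (s2 t a2 x y z w l m n u) - z^-1).
Proof. by move=> nz a_sum; rewrite ham_chart2 //; regular. Qed.

Lemma regular_chart3 : l != 0 -> regular (app8 G (s3 a3 x y z w l m n u)).
Proof. by move=> nz; rewrite ham_chart3 //; regular. Qed.

Lemma regular_chart4 : n != 0 -> regular (app8 G (s4 a4 x y z w l m n u)).
Proof. by move=> nz; rewrite ham_chart4 //; regular. Qed.

End HamiltonianInCharts.

Section Degree.
Variables (n : nat) (F : idomainType).
Implicit Types (f g : {mpoly F[n]}).

Definition deg_le d f := (msize f <= d.+1)%N.

Lemma deg_leC c : deg_le 0 c%:MP.
Proof. by rewrite /deg_le msizeC; case: eqP. Qed.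

Lemma deg_le_nat k : deg_le 0 k%:R.
Proof. by rewrite -mpolyC_nat; apply: deg_leC. Qed.

Lemma deg_le_var i : deg_le 1 'X_i.
Proof. by rewrite /deg_le msizeX mdeg1. Qed.

Lemma deg_leD d e f g : deg_le d f -> deg_le e g -> deg_le (maxn d e) (f + g).
Proof.
rewrite /deg_le => df eg; apply: leq_trans (msizeD_le _ _) _.
by rewrite -maxnSS geq_max !leq_max df eg orbT.
Qed.

Lemma deg_leN d f : deg_le d f -> deg_le d (- f).
Proof. by rewrite /deg_le msizeN. Qed.

Lemma deg_leM d e f g : deg_le d f -> deg_le e g -> deg_le (d + e) (f * g).
Proof.
rewrite /deg_le => df eg.
have [->|f0] := eqVneq f 0; first by rewrite mul0r msize0.
have [->|g0] := eqVneq g 0; first by rewrite mulr0 msize0.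
by rewrite msizeM // -subn1 leq_subLR (leq_trans (leq_add df eg)) // addnS.
Qed.

Lemma deg_leX d f k : deg_le d f -> deg_le (k * d) (f ^+ k).
Proof.
move=> df; elim: k => [|k IHk]; first exact: (deg_le_nat 1).
by rewrite exprS mulSn; apply: deg_leM.
Qed.

Lemma deg_le_trans d e f : deg_le d f -> (d <= e)%N -> deg_le e f.
Proof. by rewrite /deg_le => df de; apply: leq_trans df _. Qed.

End Degree.

Lemma ham_deg (F : fieldType) (h t a0 a1 a3 a4 : F) :
  deg_le 3 (ham h%:MP t%:MP a0%:MP a1%:MP a3%:MP a4%:MP
    'X_i_q1 'X_i_p1 'X_i_q2 'X_i_p2 'X_i_q3 'X_i_p3 'X_i_q4 'X_i_p4
    : {mpoly F[8]}).
Proof.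
rewrite /ham /halfham; apply: deg_le_trans.
  by repeat first
    [ apply: deg_leD | apply: deg_leN | apply: deg_leM | apply: deg_leX
    | apply: deg_leC | apply: deg_le_nat | apply: deg_le_var ].
by [].
Qed.

(** * Back to rational functions over C(t) *)

Section Target.
Variable R : realType.
Local Notation Ct := {fraction {poly complex R}}.
Local Notation Pol := {mpoly Ct[8]}.
Local Notation Rat := {fraction Pol}.

Let emb : {rmorphism Pol -> Rat} := @tofrac Pol.
Let embC : {rmorphism Ct -> Rat} := emb \o @mpolyC 8 Ct.

Let emb_inj : injective emb.
Proof. by move=> P Q /eqP; rewrite tofrac_eq => /eqP. Qed.

Lemma Ct_nat_neq0 k : k.+1%:R != 0 :> Ct.
Proof.
rewrite -(rmorph_nat (@tofrac {poly complex R})) tofrac_eq0 -polyC_natr.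
by rewrite polyC_eq0 Num.Theory.pnatr_eq0.
Qed.

Lemma char_Ct : [pchar Ct] =i pred0.
Proof. by apply/pcharf0P => -[|k]; rewrite ?eqxx // (negPf (Ct_nat_neq0 k)). Qed.

Lemma expr_inB (s : 8.-tuple Rat) (H K : Pol) :
  expr_in s (H - K) = expr_in s H - expr_in s K.
Proof. exact: (rmorphB (mmap embC (tnth s)) H K). Qed.

Lemma expr_in_var (s : 8.-tuple Rat) i : expr_in s 'X_i = tnth s i.
Proof. by rewrite -[LHS]/(mmap embC (tnth s) 'X_i) mmapX mmap1U. Qed.

Lemma regular_ratC c : regular emb (ratC c).
Proof. by exists c%:MP. Qed.

Lemma regular_coords i : regular emb (tnth (coords R) i).
Proof. by rewrite tnth_mktuple; exists 'X_i. Qed.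

Lemma regular_inv_nat k : regular emb (k%:R^-1).
Proof.
exists (k%:R^-1 : Ct)%:MP.
by have := fmorphV embC k%:R; rewrite !rmorph_nat.
Qed.

Lemma coords_neq0 i : tnth (coords R) i != 0.
Proof. by rewrite tnth_mktuple; apply: emb_var_neq0 emb_inj i. Qed.

Variables a0 a1 a2 a3 a4 : complex R.
Hypothesis a_sum : a0 + a1 + a2 + a3 + a4 = 1.

Lemma cst_sum : cst a0 + cst a1 + cst a2 + cst a3 + cst a4 = 1.
Proof. by rewrite /cst -!rmorphD a_sum !rmorph1. Qed.

Lemma ratC_sum : ratC (cst a0) + ratC (cst a1) + ratC (cst a2)
  + ratC (cst a3) + ratC (cst a4) = 1.
Proof.
have : embC (cst a0 + cst a1 + cst a2 + cst a3 + cst a4) = 1.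
  by rewrite cst_sum rmorph1.
by rewrite !rmorphD.
Qed.

Lemma target_hamE :
  target_ham a0 a1 a3 a4 =
  ham (3%:R / 2%:R)%:MP (tvar R)%:MP
    (cst a0)%:MP (cst a1)%:MP (cst a3)%:MP (cst a4)%:MP
    'X_i_q1 'X_i_p1 'X_i_q2 'X_i_p2 'X_i_q3 'X_i_p3 'X_i_q4 'X_i_p4.
Proof. by rewrite /target_ham -!mul_mpolyC. Qed.

Lemma target_ham_deg : (msize (target_ham a0 a1 a3 a4) <= 4)%N.
Proof. by rewrite target_hamE; apply: ham_deg. Qed.

Lemma target_ham_field :
  ham_field (target_ham a0 a1 a3 a4) = target_field a0 a1 a3 a4.
Proof.
rewrite target_hamE.
exact: (mderiv_ham (tvar R) (cst a0) (cst a1) (cst a3) (cst a4)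
  (Ct_nat_neq0 1)).
Qed.

Lemma expr_in_target (s : 8.-tuple Rat) :
  expr_in s (target_ham a0 a1 a3 a4) =
  app8 (ham (3%:R / 2%:R) (ratC (tvar R)) (ratC (cst a0)) (ratC (cst a1))
          (ratC (cst a3)) (ratC (cst a4))) s.
Proof.
rewrite -[LHS]/(mmap embC (tnth s) (target_ham a0 a1 a3 a4)).
rewrite target_hamE rmorph_ham /app8 /= !mmapC !mmapX !mmap1U.
have half : embC (3%:R / 2%:R) = 3%:R / 2%:R by rewrite fmorph_div !rmorph_nat.
by rewrite -half.
Qed.

Lemma target_regular : r_polynomial a0 a1 a2 a3 a4 (target_ham a0 a1 a3 a4).
Proof.
have nz n : n.+1%:R != 0 :> Rat by exact: (emb_nat_neq0 emb_inj n char_Ct).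
Ltac side := first [ exact: regular_ratC | exact: regular_coords
                   | exact: coords_neq0 | exact: ratC_sum ].
split.
- rewrite expr_in_target; apply: (regular_chart0 nz regular_inv_nat); side.
- rewrite expr_in_target; apply: (regular_chart1 nz regular_inv_nat); side.
- rewrite expr_inB expr_in_target expr_in_var.
  rewrite [X in _ - X](_ : _ = (tnth (coords R) i_q2)^-1); last first.
    by rewrite (tnth_nth 0).
  apply: (regular_chart2 nz regular_inv_nat); side.
- rewrite expr_in_target; apply: (regular_chart3 nz regular_inv_nat); side.
- rewrite expr_in_target; apply: (regular_chart4 nz regular_inv_nat); side.
Qed.

Lemma r_polynomial_unique (H G : Pol) : (msize H <= 4)%N -> (msize G <= 4)%N ->
  r_polynomial a0 a1 a2 a3 a4 H -> r_polynomial a0 a1 a2 a3 a4 G ->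
  exists c, H = G + c%:MP.
Proof.
move=> H4 G4 [H0 H1 H2 H3 H5] [G0 G1 G2 G3 G5].
exists ((H - G)@_(0%MM)); rewrite -[LHS](subrK G) addrC; congr (_ + _).
have K4 : (msize (H - G) <= 4)%N.
  by apply: leq_trans (msizeD_le _ _) _; rewrite msizeN geq_max H4.
have sub s : is_polynomial (expr_in s H) -> is_polynomial (expr_in s G) ->
    is_polynomial (expr_in s (H - G)).
  by rewrite expr_inB; case=> P -> [Q ->]; exists (P - Q); rewrite tofracB.
have sub2 s : is_polynomial (expr_in s (H - 'X_i_q2)) ->
    is_polynomial (expr_in s (G - 'X_i_q2)) ->
    is_polynomial (expr_in s (H - G)).
  case=> P HP [Q GQ]; exists (P - Q).
  by rewrite tofracB -HP -GQ -expr_inB opprB addrA subrK.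
exact: (regular_cubic_const emb_inj char_Ct cst_sum K4
  (sub _ H0 G0) (sub _ H1 G1) (sub2 _ H2 G2) (sub _ H3 G3) (sub _ H5 G5)).
Qed.

Lemma ham_field_addC (H : Pol) c : ham_field (H + c%:MP) = ham_field H.
Proof. by rewrite /ham_field !mderiv_addC. Qed.

End Target.

Unset Implicit Arguments.

Theorem theorem3p4 (R : realType) (a0 a1 a2 a3 a4 : complex R)
    (ha : a0 + a1 + a2 + a3 + a4 = 1)
    (H : {mpoly {fraction {poly complex R}}[8]})
    (B1 : msize H = 4%N) (* msize is the total degree plus one *)
    (B2 : r_polynomial a0 a1 a2 a3 a4 H) :
  ham_field H = target_field a0 a1 a3 a4
  /\ ham_field (target_ham a0 a1 a3 a4) = target_field a0 a1 a3 a4.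
Proof.
have H4 : (msize H <= 4)%N by rewrite B1.
have [c ->] := r_polynomial_unique ha H4 (target_ham_deg a0 a1 a3 a4)
  B2 (target_regular ha).
by rewrite ham_field_addC target_ham_field.
Qed.
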